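(* Define integers $g_n(i,j)$ ($n\ge1$, $i,j\in\mathbb Z$) by $g_1(1,0)=1$, $g_1(i,j)=0$ for $(i,j)\ne(1,0)$, and $g_{n+1}(i,j)=g_n(i-1,j)+4(1+i)g_n(i+1,j-1)+2j\, g_n(i,j)+4(n+2-i-2j)g_n(i,j-1)$. Then for $n\ge1$, $$g_n(i,j)=\#\{\pi\in\mathcal D_n^B:\ \mathrm{single}(\pi)=i,\ \mathrm{wexc}(\pi)=j,\ \mathrm{cda}(\pi)=0\}.$$
   Context: $B_n$ is the group of bijections $\pi$ of $\pm[n]$ with $\pi(-i)=-\pi(i)$; $\mathcal D_n^B$ is the set of $\pi\in B_n$ with no $i\in[n]$ such that $\pi(i)=i$. For $\pi\in\mathcal D_n^B$: $\mathrm{wexc}(\pi)=\#\{i\in[n]:\pi(|\pi(i)|)>\pi(i)\}$ and $\mathrm{single}(\pi)=\#\{i\in[n]:\pi(i)=-i\}$. Write $\pi$ in cycle form: a cycle $(c_1,\dots,c_m)$ of signed entries means $\pi(|c_k|)=c_{k+1}$ (indices mod $m$), the cycles corresponding to the cycles of $i\mapsto|\pi(i)|$. In the standard cycle decomposition each cycle is written with its largest entry (in the usual order of integers) last. An entry $c_k$ with $1<k<m$ of a cycle $(c_1,\dots,c_m)$ is a cycle double ascent if $c_{k-1}<c_k<c_{k+1}$; $\mathrm{cda}(\pi)$ is the number of cycle double ascents of $\pi$ in its standard cycle decomposition. *)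

(* Defs.v *)
(* Mathematical Components *)
From mathcomp Require Import all_boot all_order all_algebra perm.
Set Implicit Arguments.
Unset Strict Implicit.
Unset Printing Implicit Defensive.
Import Order.TTheory GRing.Theory Num.Theory.
Local Open Scope ring_scope.

(* The set {-n, ..., -1, 1, ..., n}: the pair (k, s) stands for k + 1 if s is
   false and for -(k + 1) if s is true; see sint. *)
Notation signed n := ('I_n * bool)%type.

Definition sint n (x : signed n) : int := (-1) ^+ x.2 * (x.1.+1)%:Z.
Definition spos n (i : 'I_n) : signed n := (i, false).
Definition sopp n (x : signed n) : signed n := (x.1, ~~ x.2).
Definition sabs n (x : signed n) : signed n := (x.1, false).

Definition Bgroup n : {set {perm (signed n)}} :=
  [set p : {perm (signed n)} | [forall x, p (sopp x) == sopp (p x)]].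

Definition derB n : {set {perm (signed n)}} :=
  [set p in Bgroup n | ~~ [exists i : 'I_n, p (spos i) == spos i]].

Definition single n (p : {perm (signed n)}) : nat :=
  #|[set i : 'I_n | p (spos i) == sopp (spos i)]|.

(* The entry that follows c in its cycle. *)
Definition cnext n (p : {perm (signed n)}) (c : signed n) : signed n :=
  p (sabs c).

Definition wexc n (p : {perm (signed n)}) : nat :=
  #|[set i : 'I_n | sint (cnext p (p (spos i))) > sint (p (spos i))]|.

(* For p in Bgroup n, exactly one of k and -k is an entry for each k in [n], so
   cnext p permutes the entries and its cycles on them are the cycles of p. *)
Definition entries n (p : {perm (signed n)}) : seq (signed n) :=
  [seq p (spos i) | i <- enum 'I_n].

(* For an entry c, the cycle of c written so that c comes last. *)
Definition cycle_to n (p : {perm (signed n)}) (c : signed n) :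
    seq (signed n) :=
  fingraph.orbit (cnext p) (cnext p c).

(* One word per cycle, since a cycle has exactly one largest entry. *)
Definition standard_cycles n (p : {perm (signed n)}) : seq (seq int) :=
  [seq [seq sint d | d <- cycle_to p c] | c <- entries p &
     all (fun d => sint d <= sint c) (cycle_to p c)].

(* Positions are counted from 0, so 1 < k < m reads 0 < k < m - 1. *)
Definition cda_word (w : seq int) : nat :=
  #|[set k : 'I_(size w) | [&& (0 < k)%N, (k.+1 < size w)%N,
       w`_k.-1 < w`_k & w`_k < w`_k.+1]]|.

Definition cda n (p : {perm (signed n)}) : nat :=
  (\sum_(w <- standard_cycles p) cda_word w)%N.

(* The value at n = 0 is a placeholder; the recurrence starts at n = 1. *)
Fixpoint g (n : nat) (i j : int) : int :=
  match n with
  | 0%N => 0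
  | 1%N => if (i == 1) && (j == 0) then 1 else 0
  | (_.+1 as m).+1 =>
      g m (i - 1) j + 4 * (1 + i) * g m (i + 1) (j - 1) + 2 * j * g m i j
      + 4 * (m%:Z + 2 - i - 2 * j) * g m i (j - 1)
  end.

(* Main.v *)
(* Build the signed permutations of [n+1] by inserting the entry n+1 or -(n+1)
   into a cycle. Writing i, j, k for the numbers of singletons, cyclic ascents
   and double ascents, the effect of an insertion on (i, j, k) depends only on
   whether the insertion point and its neighbours are ascents, which gives a
   recurrence for the number b_n(i, j, k) of derangements. (Deleting the
   largest entry may leave a positive fixed point; flipping its sign accounts
   for these cases.) The recurrence preserves the form
     b_n(i, p + k, k) = binomial(n - i - 2p, k) g_n(i, p),
   which is the numerical shadow of valley hopping, and k = 0 is the theorem. *)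
From HB Require Import structures.
Require Import Defs.
From mathcomp Require Import all_boot all_order all_algebra perm.
From mathcomp Require Import ring zify.
Set Implicit Arguments.
Unset Strict Implicit.
Unset Printing Implicit Defensive.
Import Order.TTheory GRing.Theory Num.Theory.
Local Open Scope ring_scope.

(** * Encoding of signed permutations and their statistics *)

(* The pair (q, s) stands for the signed permutation whose entries are the
   v with sign s v, the entry v being followed by the entry q v. *)
Notation sperm n := ('S_n * {ffun 'I_n -> bool})%type.

Definition entry n (x : sperm n) (v : 'I_n) : signed n := (v, x.2 v).

Definition asc n (x : sperm n) (v : 'I_n) : bool :=
  sint (entry x v) < sint (entry x (x.1 v)).

Definition nfix n (x : sperm n) : int := \sum_v (x.1 v == v)%:Z.
Definition nasc n (x : sperm n) : int := \sum_v (asc x v)%:Z.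
(** A double ascent is counted at its predecessor: [x.1 v] is the middle entry. All statistics are
    integers because the recurrence subtracts. *)
Definition ncda n (x : sperm n) : int := \sum_v (asc x v && asc x (x.1 v))%:Z.

(** A fixed point of [x.1] is a cycle with one entry, and the signed permutation fixes it exactly
    when that entry is positive. *)
Definition derange n (x : sperm n) : bool :=
  [forall v, (x.1 v == v) ==> x.2 v].

(** * Insertion of the largest entry *)

(** For [a = ord_max] the new entry forms a cycle of its own; for [a = lift ord_max v] it goes
    between [v] and the successor of [v]. Its sign is [e], [true] meaning negative. *)
HB.lock Definition insert n (a : 'I_n.+1) (e : bool) (x : sperm n) : sperm n.+1 :=
  ((tperm a ord_max * lift_perm ord_max ord_max x.1)%g,
   [ffun u => oapp x.2 e (unlift ord_max u)]).

(** Both sides have $2^{n+1}(n+1)!$ elements, so injectivity suffices; [a] is recovered as the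
    preimage of [ord_max]. *)
Lemma insert_bij n :
  bijective (fun y : 'I_n.+1 * bool * sperm n => insert y.1.1 y.1.2 y.2).
Proof.
apply: inj_card_bij => [[[a e] [p s]] [[a' e'] [p' s']]|]; last first.
  rewrite !card_prod !card_ffun !card_ord card_bool.
  by rewrite !card_Sn factS expnS; lia.
rewrite insert.unlock => -[ep es].
have ea : a = a'.
  apply: (perm_inj (s := (tperm a ord_max * lift_perm ord_max ord_max p)%g)).
  by rewrite {2}ep !permM !tpermL !lift_perm_id.
rewrite -ea in ep *.
have {}ep : lift_perm ord_max ord_max p = lift_perm ord_max ord_max p'.
  by apply: (mulgI (tperm a ord_max)).
congr (_, _, (_, _)).
- by have := congr1 (fun f : {ffun _ -> _} => f ord_max) es; rewrite !ffunE unlift_none.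
- apply/permP=> v; have := congr1 (fun q : 'S_n.+1 => q (lift ord_max v)) ep.
  by rewrite !lift_perm_lift => /lift_inj.
- apply/ffunP=> v; have := congr1 (fun f : {ffun _ -> _} => f (lift ord_max v)) es.
  by rewrite !ffunE liftK.
Qed.

Lemma insert_sgn n a e (x : sperm n) v : (insert a e x).2 (lift ord_max v) = x.2 v.
Proof. by rewrite insert.unlock ffunE liftK. Qed.

Lemma insert_sgn_max n a e (x : sperm n) : (insert a e x).2 ord_max = e.
Proof. by rewrite insert.unlock ffunE unlift_none. Qed.

Lemma insert_permE n (v : 'I_n) e (x : sperm n) :
  (insert (lift ord_max v) e x).1 (lift ord_max v) = ord_max.
Proof. by rewrite insert.unlock permM tpermL lift_perm_id. Qed.

Lemma insert_perm_max n (v : 'I_n) e (x : sperm n) :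
  (insert (lift ord_max v) e x).1 ord_max = lift ord_max (x.1 v).
Proof. by rewrite insert.unlock permM tpermR lift_perm_lift. Qed.

Lemma insert_perm_neq n (v : 'I_n) e (x : sperm n) u : u != v ->
  (insert (lift ord_max v) e x).1 (lift ord_max u) = lift ord_max (x.1 u).
Proof.
move=> uv; rewrite insert.unlock permM tpermD ?lift_perm_lift ?neq_lift //.
by rewrite (inj_eq lift_inj) eq_sym.
Qed.

Lemma insert_max_permE n e (x : sperm n) u :
  (insert ord_max e x).1 (lift ord_max u) = lift ord_max (x.1 u).
Proof. by rewrite insert.unlock permM tperm1 perm1 lift_perm_lift. Qed.

Lemma insert_max_perm_max n e (x : sperm n) :
  (insert ord_max e x).1 ord_max = ord_max.
Proof. by rewrite insert.unlock permM tperm1 perm1 lift_perm_id. Qed.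

Lemma sint_entry_insert n a e (x : sperm n) v :
  sint (entry (insert a e x) (lift ord_max v)) = sint (entry x v).
Proof. by rewrite /sint /entry insert_sgn /= /bump leqNgt ltn_ord. Qed.

Lemma sint_entry_insert_max n a e (x : sperm n) :
  sint (entry (insert a e x) ord_max) = (-1) ^+ e * n.+1%:Z.
Proof. by rewrite /sint /entry insert_sgn_max. Qed.

Lemma sint_entry_lt n (x : sperm n) v :
  - n.+1%:Z < sint (entry x v) /\ sint (entry x v) < n.+1%:Z.
Proof.
have := ltn_ord v; rewrite /sint /=.
by case: (x.2 v); rewrite ?expr1 ?expr0; lia.
Qed.

(** * Effect of an insertion on the statistics *)

Lemma asc_insert_neq n (x : sperm n) (v : 'I_n) e u : u != v ->
  asc (insert (lift ord_max v) e x) (lift ord_max u) = asc x u.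
Proof. by move=> uv; rewrite /asc insert_perm_neq // !sint_entry_insert. Qed.

Lemma asc_insertE n (x : sperm n) (v : 'I_n) e :
  asc (insert (lift ord_max v) e x) (lift ord_max v) = ~~ e.
Proof.
rewrite /asc insert_permE sint_entry_insert sint_entry_insert_max.
by have := sint_entry_lt x v; case: e; rewrite ?expr1 ?expr0 /=; lia.
Qed.

Lemma asc_insert_max n (x : sperm n) (v : 'I_n) e :
  asc (insert (lift ord_max v) e x) ord_max = e.
Proof.
rewrite /asc insert_perm_max sint_entry_insert sint_entry_insert_max.
by have := sint_entry_lt x (x.1 v); case: e; rewrite ?expr1 ?expr0 /=; lia.
Qed.

Lemma asc_fix n (x : sperm n) v : x.1 v = v -> asc x v = false.
Proof. by move=> xv; rewrite /asc xv ltxx. Qed.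

Lemma asc_insert_fix n (x : sperm n) e u :
  asc (insert ord_max e x) (lift ord_max u) = asc x u.
Proof. by rewrite /asc insert_max_permE !sint_entry_insert. Qed.

Lemma sum_ord_max n (R : nmodType) (f : 'I_n.+1 -> R) :
  \sum_a f a = f ord_max + \sum_v f (lift ord_max v).
Proof. exact: bigD1_ord. Qed.

Lemma nfix_insert_fix n (x : sperm n) e : nfix (insert ord_max e x) = nfix x + 1.
Proof.
rewrite /nfix sum_ord_max insert_max_perm_max eqxx addrC; congr (_ + _).
by apply: eq_bigr => u _; rewrite insert_max_permE (inj_eq lift_inj).
Qed.

Lemma nasc_insert_fix n (x : sperm n) e : nasc (insert ord_max e x) = nasc x.
Proof.
rewrite /nasc sum_ord_max asc_fix ?insert_max_perm_max // add0r.
by apply: eq_bigr => u _; rewrite asc_insert_fix.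
Qed.

Lemma ncda_insert_fix n (x : sperm n) e : ncda (insert ord_max e x) = ncda x.
Proof.
rewrite /ncda sum_ord_max asc_fix ?insert_max_perm_max // add0r.
by apply: eq_bigr => u _; rewrite insert_max_permE !asc_insert_fix.
Qed.

Lemma nfix_insert n (x : sperm n) (v : 'I_n) e :
  nfix (insert (lift ord_max v) e x) = nfix x - (x.1 v == v)%:Z.
Proof.
rewrite /nfix sum_ord_max insert_perm_max.
rewrite lift_eqF add0r.
rewrite (bigD1 v) //= [in RHS](bigD1 v) //= insert_permE. rewrite eq_liftF.
rewrite add0r addrAC subrr add0r; apply: eq_bigr => u uv.
by rewrite insert_perm_neq // (inj_eq lift_inj).
Qed.

(** The new entry is extreme in value, so whatever its sign, exactly one of the two steps around it
    is an ascent; these steps replace the one from [v]. *)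
Lemma nasc_insert n (x : sperm n) (v : 'I_n) e :
  nasc (insert (lift ord_max v) e x) = nasc x - (asc x v)%:Z + 1.
Proof.
rewrite /nasc sum_ord_max asc_insert_max.
rewrite (bigD1 v) //= [in RHS](bigD1 v) //= asc_insertE.
rewrite (eq_bigr (fun u => (asc x u)%:Z)); last first.
  by move=> u uv; rewrite asc_insert_neq.
by case: e => /=; ring.
Qed.

(** The step from [v] disappears, and with it any double ascent at [x.1 v] or at [v]. If the new
    entry is negative, the step out of it ascends and continues at [x.1 v]; if it is positive, the
    step into it ascends and continues the one from the predecessor of [v]. *)
Lemma ncda_insert n (x : sperm n) (v : 'I_n) e :
  ncda (insert (lift ord_max v) e x) =
  ncda x - (asc x v && asc x (x.1 v))%:Z
    - (asc x v && asc x ((x.1)^-1 v)%g)%:Z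
    + (asc x (if e then x.1 v else (x.1)^-1 v)%g)%:Z.
Proof.
rewrite /ncda sum_ord_max asc_insert_max insert_perm_max.
(* If [v] is alone in its cycle, it is its own predecessor and successor, and all three corrections
   vanish. *)
have [xv|xv] := eqVneq (x.1 v) v.
  have xv' : ((x.1)^-1 v)%g = v by rewrite -{1}xv permK.
  rewrite xv xv' if_same (asc_fix xv) asc_insertE andbN -addrA -addrA addr0 add0r.
  apply: eq_bigr => u _; have [->|uv] := eqVneq u v.
    by rewrite asc_insertE insert_permE asc_insert_max andNb asc_fix.
  rewrite insert_perm_neq // !asc_insert_neq //.
  by apply: contra uv => /eqP xu; rewrite -(inj_eq (@perm_inj _ x.1)) xu xv.
pose w := ((x.1)^-1 v)%g.
have xw : x.1 w = v by rewrite permKV.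
have wv : w != v by apply: contra xv => /eqP {1}<-; rewrite xw.
(* Among the old entries, only the summands at [v] and at its predecessor [w] change. *)
rewrite (bigD1 v) //= (bigD1 w) //= [in RHS](bigD1 v) //= [in RHS](bigD1 w) //=.
rewrite insert_permE insert_perm_neq // -/w xw !(asc_insertE, asc_insert_max).
rewrite !asc_insert_neq //.
rewrite (eq_bigr (fun u => (asc x u && asc x (x.1 u))%:Z)); last first.
  move=> u /andP[uv uw]; rewrite insert_perm_neq // !asc_insert_neq //.
  by apply: contra uw => /eqP xu; rewrite -(inj_eq (@perm_inj _ x.1)) xu xw.
case: e; case: (asc x v); case: (asc x w); case: (asc x (x.1 v)) => /=; ring.
Qed.

(** * Derangements and sign flips *)

Lemma forall_ord_max n (P : pred 'I_n.+1) :
  [forall a, P a] = P ord_max && [forall v, P (lift ord_max v)].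
Proof.
apply/forallP/andP => [Pall|[Pm /forallP Pl] a]; last by case: (unliftP ord_max a) => [v|] ->.
by split=> //; apply/forallP.
Qed.

Lemma derange_insert_fix n (x : sperm n) e :
  derange (insert ord_max e x) = e && derange x.
Proof.
rewrite /derange forall_ord_max insert_max_perm_max eqxx insert_sgn_max.
congr (_ && _); apply: eq_forallb => v.
by rewrite insert_max_permE insert_sgn (inj_eq lift_inj).
Qed.

(** After the insertion [v] is no longer a fixed point, so [x] may have a positive fixed point
    there. *)
Lemma derange_insert n (x : sperm n) (v : 'I_n) e :
  derange (insert (lift ord_max v) e x) =
  [forall u, (u != v) && (x.1 u == u) ==> x.2 u].
Proof.
rewrite /derange forall_ord_max insert_perm_max lift_eqF /=.
apply: eq_forallb => u; rewrite insert_sgn.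
have [->|uv] := eqVneq u v; first by rewrite insert_permE eq_liftF.
by rewrite insert_perm_neq // (inj_eq lift_inj).
Qed.

Definition flip n (v : 'I_n) (x : sperm n) : sperm n :=
  (x.1, [ffun u => (u == v) (+) x.2 u]).

Lemma flipK n (v : 'I_n) : involutive (flip v).
Proof.
case=> p s; congr (_, _); apply/ffunP=> u.
by rewrite !ffunE /= addbA addbb.
Qed.

Lemma asc_flip n (v : 'I_n) (x : sperm n) u :
  x.1 v = v -> asc (flip v x) u = asc x u.
Proof.
move=> xv; have [->|uv] := eqVneq u v; first by rewrite !asc_fix.
have xuv : x.1 u != v by apply: contra uv => /eqP xu; rewrite -(inj_eq (@perm_inj _ x.1)) xu xv.
by rewrite /asc /entry !ffunE (negPf uv) (negPf xuv).
Qed.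

(** The extra elements, with [v] a positive fixed point, correspond by [flip v] to the derangements
    with [v] a negative one; the latter are thus counted twice. *)
Lemma sum_derange_but n (v : 'I_n) (G : sperm n -> int) :
    (forall x : sperm n, x.1 v = v -> G (flip v x) = G x) ->
  \sum_(x : sperm n | [forall u, (u != v) && (x.1 u == u) ==> x.2 u]) G x =
  \sum_(x | derange x) (1 + (x.1 v == v)%:Z) * G x.
Proof.
move=> Gflip; rewrite (bigID (fun x : sperm n => (x.1 v == v) ==> x.2 v)) /=.
have derangeE (x : sperm n) :
    [forall u, (u != v) && (x.1 u == u) ==> x.2 u] && ((x.1 v == v) ==> x.2 v) =
    derange x.
  apply/andP/forallP => [[/forallP xP xv] u|xP].
    by have [->//|uv] := eqVneq u v; have := xP u; rewrite uv.
  by split=> //; apply/forallP=> u; case: eqP => //= _; apply: xP.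
rewrite (eq_bigl _ _ derangeE); under [RHS]eq_bigr do rewrite mulrDl mul1r.
rewrite [RHS]big_split; congr (_ + _).
rewrite (reindex_inj (inv_inj (flipK v))) big_mkcond [RHS]big_mkcond /=.
apply: eq_bigr => x _.
have [xv|xv] := eqVneq (x.1 v) v; last by rewrite andbF mul0r if_same.
rewrite -derangeE xv eqxx /= ffunE eqxx negbK mul1r Gflip //.
congr (if _ && _ then _ else _); apply: eq_forallb => u.
by rewrite ffunE; case: eqP.
Qed.

(** * The recurrence summed over all insertions *)

Lemma sum_insert n (D : sperm n.+1 -> int) :
  \sum_z D z = \sum_x \sum_e D (insert ord_max e x) +
    \sum_v \sum_e \sum_x D (insert (lift ord_max v) e x).
Proof.
rewrite (reindex _ (onW_bij _ (insert_bij n))).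
rewrite -(pair_bigA _ (fun ae x => D (insert ae.1 ae.2 x))) /=.
rewrite -(pair_bigA _ (fun a e => \sum_x D (insert a e x))) /= sum_ord_max.
by rewrite exchange_big.
Qed.

Lemma sum_asc_perm n (x : sperm n) : \sum_v (asc x (x.1 v))%:Z = nasc x.
Proof. by rewrite /nasc [RHS](reindex_inj (@perm_inj _ x.1)). Qed.

Lemma sum_asc_permV n (x : sperm n) : \sum_v (asc x ((x.1)^-1 v)%g)%:Z = nasc x.
Proof. by rewrite /nasc [RHS](reindex_inj (@perm_inj _ (x.1)^-1%g)). Qed.

Lemma sum_asc_ascV n (x : sperm n) :
  \sum_v (asc x v && asc x ((x.1)^-1 v)%g)%:Z = ncda x.
Proof.
rewrite (reindex_inj (@perm_inj _ x.1)); apply: eq_bigr => v _.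
by rewrite permK andbC.
Qed.

(* [b] and [c] are the ascent indicators of the predecessor and the successor
   of v, in the order that suits the sign of the inserted entry. *)
Lemma sum_insert_after n (x : sperm n) (b c : 'I_n -> bool)
    (F : int -> int -> int -> int) :
    (forall v, x.1 v = v -> c v = false) ->
    \sum_v (b v)%:Z = nasc x -> \sum_v (c v)%:Z = nasc x ->
    \sum_v (asc x v && b v)%:Z = ncda x -> \sum_v (asc x v && c v)%:Z = ncda x ->
  \sum_v (1 + (x.1 v == v)%:Z) *
     F (nfix x - (x.1 v == v)%:Z) (nasc x - (asc x v)%:Z + 1)
       (ncda x - (asc x v && b v)%:Z - (asc x v && c v)%:Z + (c v)%:Z) =
  ncda x * F (nfix x) (nasc x) (ncda x - 1)
  + (nasc x - ncda x) * F (nfix x) (nasc x) (ncda x)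
  + (nasc x - ncda x) * F (nfix x) (nasc x + 1) (ncda x + 1)
  + (n%:Z - nfix x - 2 * nasc x + ncda x) * F (nfix x) (nasc x + 1) (ncda x)
  + 2 * nfix x * F (nfix x - 1) (nasc x + 1) (ncda x).
Proof.
move=> c_fix sb sc sab sac.
set F1 := F _ _ (_ - 1); set F2 := F _ (nasc x) (ncda x).
set F3 := F _ _ (_ + 1); set F4 := F (nfix x) (_ + 1) (ncda x).
set F5 := F (_ - 1) _ _.
(* The coefficients are disjoint cases for [v]: an ascent with [b v] loses a double ascent ([F1]),
   any other ascent changes nothing ([F2]), a non-fixed descent gains an ascent, with a double
   ascent if [c v] ([F3]) and without one otherwise ([F4]), and a fixed point has weight 2
   ([F5]). *)
transitivity (\sum_v ((asc x v && b v)%:Z * F1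
   + ((asc x v)%:Z - (asc x v && b v)%:Z) * F2
   + ((c v)%:Z - (asc x v && c v)%:Z) * F3
   + (1 - (x.1 v == v)%:Z - (asc x v)%:Z - (c v)%:Z + (asc x v && c v)%:Z) * F4
   + 2 * (x.1 v == v)%:Z * F5)).
  apply: eq_bigr => v _.
  have [xv|xv] := eqVneq (x.1 v) v.
    rewrite (c_fix _ xv) (asc_fix xv) /=.
    by rewrite !subr0 ?addr0 -/F5; ring.
  rewrite !subr0; case: (asc x v); case: (b v); case: (c v) => /=;
    rewrite ?subr0 ?addr0 ?subrK -/F1 -/F2 -/F3 -/F4; ring.
rewrite !big_split -!mulr_suml !big_split /= !sumrN sab sac sc.
rewrite -mulr_sumr -/(nasc x) -/(nfix x) sumr_const card_ord.
by rewrite -/F1; ring.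
Qed.

Lemma sum_derange_rec n (F : int -> int -> int -> int) :
  \sum_(x : sperm n.+1 | derange x) F (nfix x) (nasc x) (ncda x) =
  \sum_(x : sperm n | derange x)
   (F (nfix x + 1) (nasc x) (ncda x)
    + 2 * (ncda x * F (nfix x) (nasc x) (ncda x - 1)
      + (nasc x - ncda x) * F (nfix x) (nasc x) (ncda x)
      + (nasc x - ncda x) * F (nfix x) (nasc x + 1) (ncda x + 1)
      + (n%:Z - nfix x - 2 * nasc x + ncda x) * F (nfix x) (nasc x + 1) (ncda x)
      + 2 * nfix x * F (nfix x - 1) (nasc x + 1) (ncda x))).
Proof.
rewrite big_mkcond sum_insert [RHS]big_split /=; congr (_ + _).
  rewrite [RHS]big_mkcond; apply: eq_bigr => x _.
  rewrite big_bool /= !derange_insert_fix /= addr0.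
  by rewrite nfix_insert_fix nasc_insert_fix ncda_insert_fix.
pose T (v : 'I_n) (e : bool) (x : sperm n) :=
  F (nfix x - (x.1 v == v)%:Z) (nasc x - (asc x v)%:Z + 1)
    (ncda x - (asc x v && asc x (x.1 v))%:Z
       - (asc x v && asc x ((x.1)^-1 v)%g)%:Z
       + (asc x (if e then x.1 v else (x.1)^-1 v)%g)%:Z).
transitivity (\sum_v \sum_e \sum_(x | derange x) (1 + (x.1 v == v)%:Z) * T v e x).
  apply: eq_bigr => v _; apply: eq_bigr => e _.
  rewrite -sum_derange_but => [|x xv]; last first.
    have asc_flipE : asc (flip v x) =1 asc x by move=> u; apply: asc_flip.
    rewrite /T /nasc /ncda !asc_flipE.
    by under eq_bigr do rewrite asc_flipE; under [in X in F _ _ X]eq_bigr do rewrite !asc_flipE.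
  rewrite [RHS]big_mkcond; apply: eq_bigr => x _.
  by rewrite derange_insert nfix_insert nasc_insert ncda_insert.
transitivity (\sum_v \sum_(x | derange x) \sum_e (1 + (x.1 v == v)%:Z) * T v e x).
  by apply: eq_bigr => v _; rewrite exchange_big.
rewrite exchange_big; apply: eq_bigr => x _; rewrite exchange_big big_bool /=.
have fixV (v : 'I_n) : x.1 v = v -> ((x.1)^-1 v)%g = v.
  by move=> xv; rewrite -{1}xv permK.
(* The two signs exchange the roles of predecessor and successor, and the value given by
   [sum_insert_after] depends on neither; hence the factor 2. *)
have sumT e : \sum_v (1 + (x.1 v == v)%:Z) * T v e x =
    \sum_v (1 + (x.1 v == v)%:Z) * T v false x.
  case: e => //.
  rewrite /T /= (sum_insert_after (b := fun v => asc x (x.1 v))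
    (c := fun v => asc x ((x.1)^-1 v)%g)) ?sum_asc_perm ?sum_asc_permV ?sum_asc_ascV //;
    last by move=> v xv; rewrite fixV // asc_fix.
  transitivity (\sum_v (1 + (x.1 v == v)%:Z) *
     F (nfix x - (x.1 v == v)%:Z) (nasc x - (asc x v)%:Z + 1)
       (ncda x - (asc x v && asc x ((x.1)^-1 v)%g)%:Z
         - (asc x v && asc x (x.1 v))%:Z + (asc x (x.1 v))%:Z)).
    by apply: eq_bigr => v _; congr (_ * F _ _ _); ring.
  rewrite (sum_insert_after (b := fun v => asc x ((x.1)^-1 v)%g)
    (c := fun v => asc x (x.1 v))) ?sum_asc_perm ?sum_asc_permV ?sum_asc_ascV //.
  by move=> v xv; rewrite xv asc_fix.
rewrite sumT -mulr2n -[_ *+ 2]mulr_natl; congr (_ * _).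
rewrite /T /= (sum_insert_after (b := fun v => asc x (x.1 v))
    (c := fun v => asc x ((x.1)^-1 v)%g)) ?sum_asc_perm ?sum_asc_permV ?sum_asc_ascV //.
by move=> v xv; rewrite fixV // asc_fix.
Qed.

(** * The numbers $b_n(i, j, k)$ *)

Definition count_stat n (i j k : int) : int :=
  \sum_(x : sperm n | derange x)
    [&& nfix x == i, nasc x == j & ncda x == k]%:Z.

(** This is [sum_derange_rec] for the indicator of given values of the statistics. *)
Lemma count_stat_rec n i j k :
  count_stat n.+1 i j k =
  count_stat n (i - 1) j k
  + 4 * (1 + i) * count_stat n (i + 1) (j - 1) k
  + 2 * (k + 1) * count_stat n i j (k + 1)
  + 2 * (j - k) * count_stat n i j k
  + 2 * (j - k) * count_stat n i (j - 1) (k - 1)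
  + 2 * (n%:Z - i - 2 * (j - 1) + k) * count_stat n i (j - 1) k.
Proof.
rewrite /count_stat.
rewrite (sum_derange_rec n (fun a b c => [&& a == i, b == j & c == k]%:Z)).
rewrite !mulr_sumr -!big_split; apply: eq_bigr => x _ /=.
(* A coefficient in the statistics may be replaced by one in [i], [j], [k] that agrees with it where
   the indicator is 1. *)
have term (P Q : bool) (u w : int) : P = Q -> (Q -> u = w) ->
    u * P%:Z = w * Q%:Z.
  by case: Q => -> => [-> //|_]; rewrite !mulr0.
move: (nfix x) (nasc x) (ncda x) => a b c.
rewrite !mulrDr ![2 * (_ * _)]mulrA.
rewrite (term [&& a == i, b == j & c - 1 == k] [&& a == i, b == j & c == k + 1] _ (2 * (k + 1))); [|lia..].
rewrite (term [&& a == i, b == j & c == k] [&& a == i, b == j & c == k] _ (2 * (j - k))); [|lia..].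
rewrite (term [&& a == i, b + 1 == j & c + 1 == k] [&& a == i, b == j - 1 & c == k - 1] _ (2 * (j - k))); [|lia..].
rewrite (term [&& a == i, b + 1 == j & c == k] [&& a == i, b == j - 1 & c == k] _
  (2 * (n%:Z - i - 2 * (j - 1) + k))); [|lia..].
rewrite (term [&& a - 1 == i, b + 1 == j & c == k] [&& a == i + 1, b == j - 1 & c == k] _ (4 * (1 + i))); [|lia..].
rewrite (_ : [&& a + 1 == i, b == j & c == k] = [&& a == i - 1, b == j & c == k]);
  last lia.
ring.
Qed.

Lemma count_stat_lt0 n i j k : k < 0 -> count_stat n i j k = 0.
Proof.
move=> k0; apply: big1 => x _; have c0 : 0 <= ncda x by apply: sumr_ge0.
suff /negPf -> : ncda x != k by rewrite !andbF.
by lia.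
Qed.

(** The recurrence also holds from size 0, where the only element is empty and all its statistics
    are 0. *)
Lemma count_stat1 i j k :
  count_stat 1 i j k = [&& i == 1, j == 0 & k == 0]%:Z.
Proof.
have stat0 (x : sperm 0) : [/\ nfix x = 0, nasc x = 0 & ncda x = 0].
  by split; apply: big_ord0.
rewrite /count_stat.
rewrite (sum_derange_rec 0 (fun a b c => [&& a == i, b == j & c == k]%:Z)).
rewrite (eq_bigr (fun=> [&& i == 1, j == 0 & k == 0]%:Z)) => [|x _]; last first.
  have [-> -> ->] := stat0 x.
  rewrite !(mul0r, mulr0, subr0, addr0) add0r.
  by rewrite ![_ == i]eq_sym ![_ == j]eq_sym ![_ == k]eq_sym.
rewrite sumr_const (eq_card (B := predT)) => [|x]; last by apply/forallP; case.
by rewrite card_prod card_Sn card_ffun card_ord expn0.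
Qed.

(** * The closed form with falling factorials *)

Definition falling (N : int) (k : nat) : int := \prod_(t < k) (N - t%:Z).

Lemma falling0 N : falling N 0 = 1.
Proof. exact: big_ord0. Qed.

Lemma fallingS N k : falling N k.+1 = falling N k * (N - k%:Z).
Proof. exact: big_ord_recr. Qed.

Lemma fallingSl N k : falling N k.+1 = N * falling (N - 1) k.
Proof.
rewrite /falling big_ord_recl subr0; congr (_ * _).
by apply: eq_bigr => t _; rewrite /= /bump /=; lia.
Qed.

Lemma gS n i j : g n.+2 i j =
  g n.+1 (i - 1) j + 4 * (1 + i) * g n.+1 (i + 1) (j - 1) + 2 * j * g n.+1 i j
  + 4 * (n.+1%:Z + 2 - i - 2 * j) * g n.+1 i (j - 1).
Proof. by []. Qed.

(* Multiplying by k! replaces the binomial coefficient by a falling factorial,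
   so that n - i - 2p may be any integer. *)
Lemma count_statE n (k : nat) (i p : int) :
  k`!%:Z * count_stat n.+1 i (p + k%:Z) k%:Z =
  falling (n.+1%:Z - i - 2 * p) k * g n.+1 i p.
Proof.
elim: n k i p => [|n IHn] k i p.
  rewrite count_stat1 [g 1 i p]/=.
  case: k => [|k]; first by rewrite falling0 addr0 andbT; case: ifP.
  rewrite !andbF mulr0; case: ifP => [/andP[/eqP -> /eqP ->]|]; last by rewrite mulr0.
  (* At [i = 1], [p = 0] the first factor of the falling factorial is $1 - 1 - 0 = 0$. *)
  by rewrite fallingSl mulr0 subrr !mul0r.
rewrite count_stat_rec gS.
set m := n.+1 in IHn *; set N := m%:Z + 1 - i - 2 * p.
rewrite (_ : m.+1%:Z - i - 2 * p = N); last by rewrite /N; lia.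
have IH1 := IHn k (i - 1) p; rewrite (_ : m%:Z - _ - _ = N) in IH1; last by rewrite /N; ring.
have IH2 := IHn k (i + 1) (p - 1).
rewrite (_ : m%:Z - _ - _ = N) in IH2; last by rewrite /N; ring.
have IH3 := IHn k.+1 i (p - 1).
rewrite (_ : m%:Z - _ - _ = N + 1) in IH3; last by rewrite /N; ring.
rewrite fallingSl addrK factS PoszM in IH3.
rewrite (_ : k.+1%:Z = k%:Z + 1) in IH3; last by rewrite -addn1 PoszD.
rewrite (_ : p - 1 + _ = p + k%:Z) in IH3; last ring.
have IH4 := IHn k i p; rewrite (_ : m%:Z - _ - _ = N - 1) in IH4; last by rewrite /N; ring.
have IH6 := IHn k i (p - 1).
rewrite (_ : m%:Z - _ - _ = N + 1) in IH6; last by rewrite /N; ring.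
rewrite (_ : p - 1 + _ = p + k%:Z - 1) in IH2 IH6; last ring.
have fall6 : (N + 1 - k%:Z) * falling (N + 1) k = (N + 1) * falling N k.
  by rewrite mulrC -fallingS fallingSl addrK.
(* Pascal's rule for falling factorials: $(N)_{l+1} - (N-1)_{l+1} = (l+1)\,(N-1)_l$. The case
   [k = 0] is separate, since the last index is then -1. *)
have IH5 : k`!%:Z * count_stat m i (p + k%:Z - 1) (k%:Z - 1) =
    (falling N k - falling (N - 1) k) * g m i p.
  case: (k) => [|l]; first by rewrite !falling0 count_stat_lt0 // subrr mul0r mulr0.
  rewrite factS PoszM -mulrA.
  have := IHn l i p; rewrite (_ : m%:Z - _ - _ = N - 1); last by rewrite /N; ring.
  move=> IHl; rewrite fallingSl (fallingS (N - 1) l).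
  rewrite (_ : l.+1%:Z = l%:Z + 1) ?addrA ?addrK; last by rewrite -addn1 PoszD.
  by rewrite IHl; ring.
transitivity (
  k`!%:Z * count_stat m (i - 1) (p + k%:Z) k%:Z
  + 4 * (1 + i) * (k`!%:Z * count_stat m (i + 1) (p + k%:Z - 1) k%:Z)
  + 2 * ((k%:Z + 1) * k`!%:Z * count_stat m i (p + k%:Z) (k%:Z + 1))
  + 2 * p * (k`!%:Z * count_stat m i (p + k%:Z) k%:Z)
  + 2 * p * (k`!%:Z * count_stat m i (p + k%:Z - 1) (k%:Z - 1))
  + 2 * ((N + 1 - k%:Z) * (k`!%:Z * count_stat m i (p + k%:Z - 1) k%:Z))).
  by rewrite /N; ring.
(* The multiples of [falling (N - 1) k] in [IH4] and [IH5] cancel. [IH3] and [IH6] each contribute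
   [2 * (N + 1) * falling N k * g m i (p - 1)], which gives the coefficient 4 in [g]. Everything
   left has the factor [falling N k]. *)
rewrite IH1 IH2 IH3 IH4 IH5 IH6 [(N + 1 - k%:Z) * _]mulrA fall6.
by rewrite (_ : m%:Z + 2 - i - 2 * p = N + 1) /N; ring.
Qed.

(** * Correspondence with signed permutations *)

(** A positive argument goes to the entry that follows it; adding the sign of the argument makes the
    map odd. *)
Definition perm_fun n (x : sperm n) (c : signed n) : signed n :=
  (x.1 c.1, x.2 (x.1 c.1) (+) c.2).

Lemma perm_fun_inj n (x : sperm n) : injective (perm_fun x).
Proof. by move=> [u b] [w c] [/perm_inj -> /addbI ->]. Qed.

Definition to_perm n (x : sperm n) : {perm (signed n)} := perm (@perm_fun_inj n x).

Lemma to_perm_spos n (x : sperm n) i : to_perm x (spos i) = entry x (x.1 i).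
Proof. by rewrite permE /perm_fun /= addbF. Qed.

Lemma cnext_to_perm n (x : sperm n) (c : signed n) :
  cnext (to_perm x) c = entry x (x.1 c.1).
Proof. exact: to_perm_spos. Qed.

Lemma to_perm_inj n : injective (@to_perm n).
Proof.
move=> x y xy.
have xyE v : entry x (x.1 v) = entry y (y.1 v) by rewrite -!to_perm_spos xy.
have xy1 : x.1 = y.1 by apply/permP=> v; case: (xyE v).
rewrite [x]surjective_pairing [y]surjective_pairing xy1; congr (_, _).
apply/ffunP=> v; have := xyE ((x.1)^-1 v)%g.
by rewrite xy1 !permKV => -[].
Qed.

Lemma derB_to_perm n : derB n = @to_perm n @: [set x | derange x].
Proof.
apply/setP=> p; apply/idP/imsetP; last first.
  move=> [x]; rewrite inE => /forallP xP ->; rewrite !inE; apply/andP; split.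
    by apply/forallP=> -[u b]; rewrite !permE /perm_fun /sopp /= addbN.
  apply/existsPn=> i; rewrite to_perm_spos; apply: contraT; rewrite negbK.
  by case/eqP=> xi; have := xP i; rewrite xi eqxx => /= ->.
rewrite !inE => /andP[/forallP pN /existsPn pfix].
(* Equal absolute values of the images of [u] and [v] give [p u = p v] or [p u = p (- v)];
   injectivity excludes the second, as both arguments would have to be positive. *)
have f_inj : injective (fun v => (p (spos v)).1).
  move=> u v uv; have [ebit|ebit] := eqVneq (p (spos u)).2 (p (spos v)).2.
    have /perm_inj [//] : p (spos u) = p (spos v).
    by rewrite [LHS]surjective_pairing uv ebit -surjective_pairing.
  have : p (spos u) = p (sopp (spos v)).
    rewrite (eqP (pN _)) /sopp -uv [LHS]surjective_pairing; congr (_, _).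
    by case: (_.2) (_.2) ebit => -[].
  by move/perm_inj => [].
(* The sign of an entry belongs to its absolute value [v], so it is read at the preimage of [v]
   under [q]. *)
pose q := perm f_inj; pose s := [ffun v => (p (spos ((q^-1)%g v))).2].
have pE v : p (spos v) = entry (q, s) (q v).
  by rewrite /entry /= ffunE permK permE -surjective_pairing.
exists (q, s).
  rewrite inE; apply/forallP=> v; apply/implyP=> /eqP /= qv.
  have := pfix v; rewrite pE qv /entry /=.
  by case: (s v) => //; rewrite eqxx.
apply/permP=> -[v []]; last by rewrite to_perm_spos -pE.
have -> : (v, true) = sopp (spos v) by [].
have /forallP/(_ (spos v))/eqP -> : [forall c, to_perm (q, s) (sopp c) == sopp (to_perm (q, s) c)].
  by apply/forallP=> -[u b]; rewrite !permE /perm_fun /sopp /= addbN.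
by rewrite (eqP (pN _)) to_perm_spos pE.
Qed.

Lemma card_derB n (P : pred {perm (signed n)}) :
  #|[set p in derB n | P p]| = #|[set x : sperm n | derange x && P (to_perm x)]|.
Proof.
rewrite -(card_imset _ (@to_perm_inj n)); apply: eq_card => p.
rewrite inE derB_to_perm; apply/andP/imsetP => [[/imsetP[x xd ->] Px]|[x xd ->]].
  by exists x => //; move: xd; rewrite !inE => ->.
rewrite inE in xd; have [xd1 xd2] := andP xd; split=> //.
by apply/imsetP; exists x; rewrite ?inE.
Qed.

Lemma card_setZ (T : finType) (P : pred T) :
  #|[set x | P x]|%:Z = \sum_x (P x)%:Z.
Proof.
rewrite -sum1_card big_mkcond /= (big_morph Posz PoszD (erefl _)).
by apply: eq_bigr => x _; rewrite inE; case: (P x).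
Qed.

(** * Transfer of the statistics *)

Lemma single_to_perm n (x : sperm n) :
  derange x -> (single (to_perm x))%:Z = nfix x.
Proof.
move=> /forallP xd; rewrite card_setZ; apply: eq_bigr => i _.
rewrite to_perm_spos /sopp /= xpair_eqE.
by case: eqP => //= xi; have := xd i; rewrite xi eqxx => /= ->.
Qed.

Lemma wexc_to_perm n (x : sperm n) : (wexc (to_perm x))%:Z = nasc x.
Proof.
rewrite card_setZ -sum_asc_perm; apply: eq_bigr => i _.
by rewrite to_perm_spos cnext_to_perm.
Qed.

Lemma entry_inj n (x : sperm n) : injective (entry x).
Proof. by move=> u v []. Qed.

Lemma sint_entry_inj n (x : sperm n) : injective (fun v => sint (entry x v)).
Proof.
move=> u v; rewrite /sint /= => uv; apply: ord_inj.
by case: (x.2 u) (x.2 v) uv => -[]; rewrite ?expr1 ?expr0; lia.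
Qed.

Lemma iter_cnext n (x : sperm n) v k :
  iter k (cnext (to_perm x)) (entry x v) = entry x (iter k x.1 v).
Proof. by elim: k => //= k ->; rewrite cnext_to_perm. Qed.

(** The injective map [entry x] carries [x.1] to [cnext], so it matches the iterates and the cycle
    lengths. *)
Lemma cycle_to_entry n (x : sperm n) v :
  cycle_to (to_perm x) (entry x v) = [seq entry x u | u <- fingraph.orbit x.1 (x.1 v)].
Proof.
rewrite /cycle_to cnext_to_perm /= /fingraph.orbit.
set w := x.1 v; set f := cnext _.
have -> : order f (entry x w) = order x.1 w.
  rewrite /order -(card_image (@entry_inj _ x)); apply: eq_card => c.
  apply/idP/imageP => [wc|[u wu ->]].
    exists (iter (findex f (entry x w) c) x.1 w); first exact: fconnect_iter.
    by rewrite -iter_cnext iter_findex.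
  by rewrite -(iter_findex wu) -iter_cnext; apply: fconnect_iter.
apply: (@eq_from_nth _ (entry x w)) => [|k]; first by rewrite size_map !size_traject.
rewrite size_traject => k_lt; rewrite (nth_map w) ?size_traject //.
by rewrite !nth_traject // iter_cnext.
Qed.

Definition cycle_max n (x : sperm n) (v : 'I_n) : bool :=
  [forall u, fconnect x.1 v u ==> (sint (entry x u) <= sint (entry x v))].

Lemma cycle_maxE n (x : sperm n) v :
  all (fun d => sint d <= sint (entry x v)) (cycle_to (to_perm x) (entry x v)) =
  cycle_max x v.
Proof.
rewrite cycle_to_entry; apply/allP/forallP => [vmax u|vmax c /mapP[u uv ->]].
  apply/implyP=> vu; apply: vmax; apply: map_f.
  by rewrite -fconnect_orbit -same_fconnect1 //; apply: perm_inj.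
apply: (implyP (vmax u)); rewrite (same_fconnect1 (@perm_inj _ x.1)).
by rewrite fconnect_orbit.
Qed.

(* The cycle is read from its maximum v, so the condition on the positions is
   automatic: the first and the last entry are never double ascents. *)
Lemma cda_word_cycle n (x : sperm n) v : cycle_max x v ->
  cda_word [seq sint d | d <- cycle_to (to_perm x) (entry x v)] =
  (\sum_(u | fconnect x.1 v u) (asc x u && asc x (x.1 u)))%N.
Proof.
move=> /forallP vmax; rewrite cycle_to_entry /fingraph.orbit.
have -> : order x.1 (x.1 v) = order x.1 v.
  by apply: eq_card => u; rewrite !inE -same_fconnect1 //; apply: perm_inj.
set m := order x.1 v; set w := map _ _.
have sw : size w = m by rewrite !size_map size_traject.
(* [G k] is the value [k] steps after the maximum [v]. The word starts at the successor of [v],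
   hence the shift by one in [nth_w]. *)
pose G k := sint (entry x (iter k x.1 v)).
have nth_w k : (k < m)%N -> w`_k = G k.+1.
  move=> km; rewrite /w -map_comp (nth_map (x.1 v)) ?size_traject //.
  by rewrite nth_traject //= -iterSr.
have G_max k : G k <= G 0 by apply: (implyP (vmax _)); apply: fconnect_iter.
have Gm : G m = G 0 by rewrite /G iter_order //; apply: perm_inj.
rewrite (eq_bigl (mem (fingraph.orbit x.1 v))); last by move=> u; rewrite /= -fconnect_orbit.
rewrite -big_uniq ?orbit_uniq //= /fingraph.orbit -/m.
rewrite /cda_word -sum1_card big_mkcond /=.
rewrite (big_nth v) size_traject -sw big_mkord; apply: eq_bigr => k _.
have km : (k < m)%N by rewrite -sw.
rewrite inE nth_traject // /asc -/(G k) -!iterS -/(G k.+1) -/(G k.+2).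
move: (nat_of_ord k) km => {}k km; rewrite sw.
case: (posnP k) => [->|k0].
  by rewrite [G 0 < _]ltNge G_max.
case: (ltnP k.+1 m) => [k1m|mk1]; last first.
  have k1 : k.+1 = m by apply/eqP; rewrite eqn_leq km.
  by rewrite k1 Gm [G 0 < _]ltNge G_max /= andbF.
by rewrite !nth_w ?prednK //; apply: ltnW.
Qed.

(** Each cycle has one maximum, so summing over maxima and then over their cycles meets every [u]
    once. The boolean equality lets the inner sum in [cda_to_perm] collapse to one term. *)
Lemma cycle_max_unique n (x : sperm n) u :
  exists v0, forall v, (cycle_max x v && fconnect x.1 v u) = (v == v0).
Proof.
have sym v w : fconnect x.1 v w = fconnect x.1 w v.
  by apply: fconnect_sym; apply: perm_inj.
case: (@Order.TotalTheory.arg_maxP _ _ _ u (fconnect x.1 u) (fun v => sint (entry x v))) => [|v0 uv0 v0max].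
  exact: connect0.
exists v0 => v; apply/andP/eqP => [[/forallP vmax vu]|->]; last first.
  rewrite sym; split=> //; apply/forallP=> w; apply/implyP=> v0w.
  by apply: v0max; apply: connect_trans v0w.
apply: (@sint_entry_inj _ x); apply: le_anti; apply/andP; split.
  by apply: v0max; rewrite sym.
by apply: (implyP (vmax _)); apply: connect_trans uv0.
Qed.

Lemma cda_to_perm n (x : sperm n) : (cda (to_perm x))%:Z = ncda x.
Proof.
rewrite /cda /standard_cycles big_map big_filter /entries big_map big_enum_cond /=.
under eq_bigl do rewrite to_perm_spos cycle_maxE.
under eq_bigr do rewrite to_perm_spos.
rewrite -(reindex_inj (@perm_inj _ x.1) (P := cycle_max x)
  (F := fun v => cda_word [seq sint d | d <- cycle_to (to_perm x) (entry x v)])).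
rewrite (eq_bigr _ (@cda_word_cycle n x)) (exchange_big_dep predT) //=.
rewrite (big_morph Posz PoszD (erefl _)); apply: eq_bigr => u _.
have [v0 v0P] := cycle_max_unique x u.
by rewrite (eq_bigl _ _ v0P) big_pred1_eq.
Qed.

Theorem theorem6 (n : nat) (hn : (1 <= n)%N) (i j : int) :
  g n i j =
  #|[set p in derB n | [&& (single p)%:Z == i, (wexc p)%:Z == j
                         & cda p == 0%N]]|%:Z.
Proof.
(* At [k = 0] both the factorial and the falling factorial are 1. *)
case: n hn => // n _; have := count_statE n 0 i j.
rewrite falling0 fact0 addr0 !mul1r => <-.
rewrite card_derB card_setZ [LHS]big_mkcond; apply: eq_bigr => x _.
case: ifP => //= xd; rewrite single_to_perm // wexc_to_perm.
by rewrite -[cda _ == _]eqz_nat cda_to_perm.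
Qed.
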